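(* Let $(X_i)$ be iid with distribution $F$ supported on $[0,\infty)$ with infinite right endpoint, $S_n=X_1+\cdots+X_n$, and assume $F$ is subexponential and $F$ belongs to the maximum domain of attraction of the Gumbel distribution $\Lambda$. Let $c_n>0$, $d_n\in\mathbb R$ be constants with $n\,\overline F(d_n+xc_n)\to e^{-x}$ for every $x\in\mathbb R$ (for example $n\overline F(d_n)\to1$ and $c_n=a(d_n)$ with the auxiliary function $a$ of the Gumbel domain). Assume there is a sequence $\gamma_n\to\infty$ such that $$\sup_{x>\gamma_n}\Big|\frac{\mathbb P(S_n-\mathbb E[S_n]>x)}{n\,\mathbb P(X_1>x)}-1\Big|\to0,\qquad n\to\infty,$$ and let $p=p_n\to\infty$ be an integer sequence such that for every $x<0$, $d_{np}+x\,c_{np}>\gamma_n$ for all sufficiently large $n$. Then $$p\,\mathbb P\big(S_n-\mathbb E[S_n]>d_{np}+x\,c_{np}\big)\to e^{-x},\qquad x\in\mathbb R,\ n\to\infty. \tag{$**$}$$ Moreover $( ** )$ is equivalent to each of: (1) $N_p=\sum_{i=1}^p\varepsilon_{c_{np}^{-1}(S_{ni}-\mathbb E[S_n]-d_{np})}\xrightarrow{d} N$ on $\mathbb R$, where $N$ is a Poisson random measure on $\mathbb R$ with mean measure $\mu(x,\infty)=e^{-x}$; (2) $\max_{i=1,\dots,p}c_{np}^{-1}\big(S_{ni}-\mathbb E[S_n]-d_{np}\big)\xrightarrow{d}Y\sim\Lambda$.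
   Context: A distribution $F$ on $[0,\infty)$ is subexponential if $\mathbb P(S_n>x)\sim n\overline F(x)$ as $x\to\infty$ for every $n\ge2$, where $\overline F=1-F$. $F$ is in the maximum domain of attraction of $\Lambda(x)=\exp(-e^{-x})$ (with infinite right endpoint) iff there is a positive function $a$ with $a'(x)\to0$ and $\overline F(u+a(u)x)/\overline F(u)\to e^{-x}$ as $u\to\infty$ for all real $x$. For each $n$, $(S_{ni})_{i\ge1}$ are iid copies of $S_n$; $\varepsilon_x$ is Dirac measure at $x$; $c_{np},d_{np}$ denote $c_m,d_m$ evaluated at $m=n\,p_n$. *)

(* Defs.v *)
From HB Require Import structures.
From mathcomp Require Import all_boot all_order all_algebra.
From mathcomp Require Import all_classical all_reals all_analysis.
From mathcomp Require Import measurable_realfun.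
Set Implicit Arguments. Unset Strict Implicit. Unset Printing Implicit Defensive.
Import Order.TTheory GRing.Theory Num.Theory.
Import numFieldNormedType.Exports.
Local Open Scope classical_set_scope.
Local Open Scope ring_scope.

Section defs.
Context {R : realType}.

Definition mutually_independent {d d'} {T : measurableType d}
  {V : measurableType d'} {I : eqType} (P : probability T R) (Y : I -> T -> V)
  : Prop :=
  forall (J : seq I) (B : I -> set V), uniq J -> (forall i, measurable (B i)) ->
    P (\bigcap_(i in [set` J]) (Y i @^-1` B i)) =
    (\prod_(i <- J) P (Y i @^-1` B i))%E.

Definition identically_distributed {d} {T : measurableType d}
  (P : probability T R) (X : nat -> T -> R) : Prop :=
  forall i (B : set R), measurable B -> P (X i @^-1` B) = P (X 0%N @^-1` B).

Definition tailP {d} {T : measurableType d} (P : probability T R)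
  (Y : T -> R) (x : R) : R := fine (P [set w | x < Y w]).

Definition Ssum {T : Type} (X : nat -> T -> R) (n : nat) (w : T) : R :=
  \sum_(i < n) X i w.

(* E[S_n] (real valued; finite under integrability of X_0) *)
Definition ES {d} {T : measurableType d} (P : probability T R)
  (X : nat -> T -> R) (n : nat) : R :=
  fine (\int[P]_w (Ssum X n w)%:E)%E.

Definition subexponential {d} {T : measurableType d} (P : probability T R)
  (X : nat -> T -> R) : Prop :=
  forall n : nat, (2 <= n)%N ->
    (tailP P (Ssum X n) x / (n%:R * tailP P (X 0%N) x)) @[x --> +oo] --> (1 : R).

(* Fbar is the tail of a distribution in the maximum domain of attraction
   of the Gumbel law (infinite right endpoint assumed separately) *)
Definition gumbel_MDA (Fbar : R -> R) : Prop :=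
  exists a : R -> R,
    (forall u, 0 < a u) /\
    (\forall u \near +oo, derivable a u 1) /\
    (derive1 a u @[u --> +oo] --> (0 : R)) /\
    (forall x : R, (Fbar (u + a u * x) / Fbar u) @[u --> +oo] --> expR (- x)).

Definition CKplus (f : R -> R) : Prop :=
  continuous f /\ (forall x, 0 <= f x) /\
  exists K : set R, compact K /\ (forall x, ~ K x -> f x = 0).

Definition radon_measure (m : {measure set R -> \bar R}) : Prop :=
  forall K : set R, compact K -> (m K < +oo)%E.

Definition point_measure (m : {measure set R -> \bar R}) : Prop :=
  radon_measure m /\
  forall A : set R, measurable A ->
    (exists k : nat, m A = (k%:R)%:E) \/ m A = +oo%E.

Definition vague_cvg (m : nat -> {measure set R -> \bar R})
  (ml : {measure set R -> \bar R}) : Prop :=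
  forall f, CKplus f ->
    (\int[m k]_x (f x)%:E)%E @[k --> \oo] --> (\int[ml]_x (f x)%:E)%E.

(* bounded functions on M_p(R), continuous for the vague topology
   (sequential continuity; the vague topology on M_p(R) is metrizable) *)
Definition bdd_vague_continuous (g : {measure set R -> \bar R} -> R) : Prop :=
  (exists M : R, forall m, point_measure m -> `|g m| <= M) /\
  (forall (m : nat -> {measure set R -> \bar R}) ml,
      (forall k, point_measure (m k)) -> point_measure ml ->
      vague_cvg m ml -> g (m k) @[k --> \oo] --> g ml).

Definition cvgd_pp {d d'} {T : measurableType d} {T' : measurableType d'}
  (P : probability T R) (Nn : nat -> T -> {measure set R -> \bar R})
  (Q : probability T' R) (N : T' -> {measure set R -> \bar R}) : Prop :=
  forall g, bdd_vague_continuous g ->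
    (\int[P]_w (g (Nn n w))%:E)%E @[n --> \oo] --> (\int[Q]_w (g (N w))%:E)%E.

Definition is_PRM {d} {T : measurableType d} (Q : probability T R)
  (N : T -> {measure set R -> \bar R}) (mu : {measure set R -> \bar R}) : Prop :=
  (forall w, point_measure (N w)) /\
  (forall A : set R, measurable A -> measurable_fun setT (fun w => N w A : \bar R)) /\
  (forall A : set R, measurable A -> (mu A < +oo)%E -> forall k : nat,
     Q [set w | N w A = (k%:R)%:E] =
     (expR (- fine (mu A)) * fine (mu A) ^+ k / (k`!)%:R)%:E) /\
  (forall A : set R, measurable A -> mu A = +oo%E ->
     Q [set w | N w A = +oo%E] = 1%E) /\
  (forall (k : nat) (A : 'I_k -> set R), (forall i, measurable (A i)) ->
     (forall i j, i != j -> A i `&` A j = set0) ->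
     mutually_independent Q (fun i w => N w (A i))).

Definition Npp {T : Type} (Z : nat -> T -> R) (p : nat) (w : T)
  : {measure set R -> \bar R} :=
  msum (fun i => \d_(Z i w)) p.

(* max_{i < p} Z_i(w)  (meaningful for p >= 1) *)
Definition maxZ {T : Type} (Z : nat -> T -> R) (p : nat) (w : T) : R :=
  \big[Num.max/Z 0%N w]_(i < p) Z i w.

End defs.

(* Main.v *)
(** Since every point [d_np + x c_np] eventually lies beyond [gamma_n], the
    large deviation bound turns [p P(S_n - E S_n > d_np + x c_np)] into
    [n p P(X_1 > d_np + x c_np)] up to a factor tending to 1, which gives
    the tail limit.  As that limit holds outright, both equivalences reduce to
    proving their right-hand sides.

    Point processes: the numbers of points of [N_p] in finitely many disjoint
    cells are multinomial, and converge in law to independent Poisson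
    variables.  Point measures having the same counts as a given [mu] in the
    cells of a grid with mesh tending to 0 and window tending to the line
    converge vaguely to [mu].  Hence a nonnegative vaguely continuous [g] is
    the limit of its lower envelopes [L_m <= g], where [L_m] depends only on
    the counts in the m-th grid, and Fatou's lemma for counts gives
    [liminf E g(N_p) >= E g(N)]; apply this to [M + g] and [M - g].  The
    maximum is the void probability, a one-cell instance. *)
Require Import Defs.
From HB Require Import structures.
From mathcomp Require Import all_boot all_order all_algebra.
From mathcomp Require Import all_classical all_reals all_analysis.
From mathcomp Require Import measurable_realfun.
From mathcomp Require Import ring lra.
Import Order.TTheory GRing.Theory Num.Theory.
Import numFieldNormedType.Exports.
Local Open Scope classical_set_scope.
Local Open Scope ring_scope.
Set Implicit Arguments. Unset Strict Implicit. Unset Printing Implicit Defensive.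

(** * The Poisson limit of multinomial probabilities *)

Section limits.
Context {R : realType}.
Implicit Types (t : R^nat) (p : nat -> nat).

Lemma cvg0_of_scaled p t (l : R) :
  ((p n)%:R : R) @[n --> \oo] --> +oo ->
  (p n)%:R * t n @[n --> \oo] --> l -> t n @[n --> \oo] --> 0.
Proof.
move=> p_oo ptl.
have p_gt0 : \forall n \near \oo, 0 < ((p n)%:R : R) by exact: (cvgry_gt p_oo).
have pV0 : (p n)%:R^-1 @[n --> \oo] --> (0 : R) by apply/gtr0_cvgV0.
rewrite -(mul0r l).
apply: (@cvg_trans _ ((p n)%:R^-1 * ((p n)%:R * t n) @[n --> \oo])); last exact: cvgM.
apply: near_eq_cvg; near=> n; rewrite mulKf // gt_eqF//; near: n; exact: p_gt0.
Unshelve. all: by end_near. Qed.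

(** Since [t n] tends to 0, the bounds [exp(- t / (1 - t)) <= 1 - t <= exp(- t)], valid for [t < 1],
    can be raised to the power [p n] and squeezed. *)
Lemma cvg_one_sub_expr p t (l : R) :
  ((p n)%:R : R) @[n --> \oo] --> +oo ->
  (forall n, 0 <= t n) ->
  (p n)%:R * t n @[n --> \oo] --> l ->
  (1 - t n) ^+ p n @[n --> \oo] --> expR (- l).
Proof.
move=> p_oo t_ge0 ptl; have t0 := cvg0_of_scaled p_oo ptl.
have lower : expR (- ((p n)%:R * t n / (1 - t n))) @[n --> \oo] --> expR (- l).
  apply: continuous_cvg; first exact: continuous_expR.
  suff : (p n)%:R * t n * (1 - t n)^-1 @[n --> \oo] --> l * (1 - 0)^-1.
    by rewrite subr0 invr1 mulr1 => /cvgN.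
  apply: cvgM => //; apply: cvgV; first by rewrite subr0 oner_neq0.
  by apply: cvgB => //; exact: cvg_cst.
have upper : expR (- ((p n)%:R * t n)) @[n --> \oo] --> expR (- l).
  by apply: continuous_cvg; [exact: continuous_expR | exact: cvgN].
apply: (squeeze_cvgr _ lower upper); near=> n.
have t_lt1 : 0 < 1 - t n.
  by rewrite subr_gt0; near: n; exact: (cvgr_lt _ t0 _ ltr01).
rewrite -mulrA -!(mulrN (p n)%:R) !expRM_natl.
apply/andP; split; apply: lerXn2r; rewrite ?nnegrE ?expR_ge0 ?(ltW t_lt1)//; last first.
  by have := expR_ge1Dx (- t n).
rewrite expRN invf_ple ?posrE ?expR_gt0//.
apply: le_trans (expR_ge1Dx _).
by rewrite [leRHS](_ : _ = (1 - t n)^-1)//; field; exact: lt0r_neq0.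
Unshelve. all: by end_near. Qed.

(** By induction on [k]: the extra factor is [(p - k) / p = 1 - k / p], which tends to 1. *)
Lemma cvg_ffact_scaled p (k : nat) :
  ((p n)%:R : R) @[n --> \oo] --> +oo ->
  (p n ^_ k)%:R / (p n)%:R ^+ k @[n --> \oo] --> (1 : R).
Proof.
move=> p_oo.
have p_gt0 : \forall n \near \oo, 0 < ((p n)%:R : R) by exact: (cvgry_gt p_oo).
have pV0 : (p n)%:R^-1 @[n --> \oo] --> (0 : R) by apply/gtr0_cvgV0.
elim: k => [|k IHk].
  by apply: cvg_near_cst; near=> n; rewrite ffactn0 expr0 divr1.
rewrite [X in _ --> X](_ : 1 = 1 * (1 - k%:R * 0)); last by rewrite mulr0 subr0 mulr1.
apply: (@cvg_trans _
  ((p n ^_ k)%:R / (p n)%:R ^+ k * (1 - k%:R * (p n)%:R^-1) @[n --> \oo])); last first.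
  apply: cvgM => //; apply: cvgB; first exact: cvg_cst.
  by apply: cvgM => //; exact: cvg_cst.
apply: near_eq_cvg; near=> n.
have kp : (k <= p n)%N.
  by rewrite -(ler_nat R); near: n; exact: (cvgry_ge p_oo).
have pn0 : ((p n)%:R : R) != 0 by rewrite gt_eqF//; near: n; exact: p_gt0.
by rewrite ffactnSr natrM natrB// exprS; field; rewrite pn0 expf_neq0.
Unshelve. all: by end_near. Qed.

End limits.

Section multinomial.
Context {R : realType} {J : nat}.
Implicit Types (q lam : 'I_J -> R) (k : {ffun 'I_J -> nat}).

Lemma cvg_prod_seq (I : Type) (r : seq I) (f : nat -> I -> R) (l : I -> R) :
  (forall i, f n i @[n --> \oo] --> l i) ->
  \prod_(i <- r) f n i @[n --> \oo] --> \prod_(i <- r) l i.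
Proof.
move=> fl; elim: r => [|i r IHr].
  rewrite big_nil; apply: cvg_near_cst; near=> n; exact: big_nil.
rewrite big_cons; under eq_fun do rewrite big_cons.
exact: cvgM.
Unshelve. all: by end_near. Qed.

(** The cells need not be exhaustive: the residual class has probability [1 - \sum_j q j]. The
    falling factorial over the [(k j)!] is the multinomial coefficient; it vanishes when the counts
    exceed [p], so the truncated exponent does no harm. *)
Definition multinomial_pmf q p k : R :=
  (p ^_ (\sum_j k j))%:R * (\prod_j (q j ^+ k j / (k j)`!%:R)) *
  (1 - \sum_j q j) ^+ (p - \sum_j k j).

Definition poisson_prod_pmf lam k : R :=
  \prod_j (expR (- lam j) * lam j ^+ k j / (k j)`!%:R).

(** The counts before a last trial that fell in cell [j]. The subtraction is truncated, hence the
    side condition [0 < k j] wherever it is used. *)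
Definition dec_ffun k (j : 'I_J) : {ffun 'I_J -> nat} :=
  [ffun i => k i - (i == j)]%N.

Lemma sum_dec_ffun k j : (0 < k j)%N ->
  (\sum_i k i = (\sum_i dec_ffun k j i).+1)%N.
Proof.
move=> kj; rewrite (bigD1 j)//= [in RHS](bigD1 j)//= ffunE eqxx.
rewrite -addSn -subSn// subSS subn0; congr addn.
by apply: eq_bigr => i ij; rewrite ffunE (negPf ij) subn0.
Qed.

Lemma prod_dec_ffun q k j : (0 < k j)%N ->
  q j * \prod_i (q i ^+ dec_ffun k j i / (dec_ffun k j i)`!%:R) =
  (k j)%:R * \prod_i (q i ^+ k i / (k i)`!%:R).
Proof.
move=> kj; rewrite (bigD1 j)//= [in RHS](bigD1 j)//= ffunE eqxx.
under eq_bigr => i ij do rewrite ffunE (negPf ij) subn0.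
rewrite !mulrA; congr (_ * _); case: (k j) kj => // m _.
rewrite subn1 /= exprS factS natrM; field.
by rewrite pnatr_eq0 -lt0n fact_gt0 /= nat1r pnatr_eq0.
Qed.

Lemma multinomial_pmf0 q k : multinomial_pmf q 0 k = (k == [ffun=> 0%N])%:R.
Proof.
rewrite /multinomial_pmf sub0n expr0 mulr1; case: eqP => [->|kn0].
  rewrite big1 => [|j _]; last by rewrite ffunE.
  by rewrite ffactn0 big1 ?mulr1// => j _; rewrite ffunE expr0 fact0 divr1.
suff -> : 0 ^_ (\sum_j k j) = 0%N by rewrite mul0r.
rewrite ffact_small// lt0n sum_nat_eq0; apply/negP => /forallP k0; apply: kn0.
by apply/ffunP => j; rewrite ffunE; apply/eqP; exact: k0.
Qed.

(* Conditioning on the class of the last of the [p.+1] trials. *)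
Lemma multinomial_pmfS q p k :
  multinomial_pmf q p.+1 k = (1 - \sum_j q j) * multinomial_pmf q p k +
    \sum_(j | (0 < k j)%N) q j * multinomial_pmf q p (dec_ffun k j).
Proof.
set r := 1 - _; set K := (\sum_j k j)%N.
have term j : (0 < k j)%N -> q j * multinomial_pmf q p (dec_ffun k j) =
    (k j)%:R * ((p ^_ K.-1)%:R * (\prod_i (q i ^+ k i / (k i)`!%:R)) * r ^+ (p.+1 - K)).
  move=> kj; have KE := sum_dec_ffun kj.
  rewrite /multinomial_pmf -/r /K KE /= subSS.
  by rewrite mulrA [q j * (_ * _)]mulrCA (prod_dec_ffun q kj); ring.
rewrite (eq_bigr _ (fun j => @term j)) -mulr_suml -natr_sum.
have -> : (\sum_(j | (0 < k j)%N) k j = K)%N.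
  rewrite /K [RHS](bigID (fun j => 0 < k j)%N) /= [X in (_ + X)%N]big1 ?addn0//.
  by move=> j; rewrite lt0n negbK => /eqP.
rewrite /multinomial_pmf -/r -/K; case: K {term} => [|K] /=.
  by rewrite !ffactn0 !subn0 exprS; ring.
rewrite subSS; have [Kp|pK] := ltnP K p.
  rewrite -(subnSK Kp) exprS ffactSS.
  (* Splits [p + 1] as [(p - K) + (K + 1)]: the residual class and the hits of the last trial. *)
  have -> : (p.+1 * p ^_ K = p ^_ K.+1 + K.+1 * p ^_ K)%N.
    by rewrite ffactnSr mulnC [(K.+1 * _)%N]mulnC -mulnDr addnS subnK// ltnW.
  by rewrite natrD natrM; ring.
rewrite (@ffact_small p K.+1)// !mul0r mulr0 add0r.
(* The residual term is gone since [p <= K]. If [K = p] every trial hits a cell; if [K > p] both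
   sides are 0. *)
have [->|Kp] := eqVneq K p; first by rewrite ffactSS natrM; ring.
have {}Kp : (p < K)%N by rewrite ltn_neqAle eq_sym Kp.
by rewrite !ffact_small// !mul0r mulr0.
Qed.

Lemma cvg_multinomial_pmf (p : nat -> nat) (q : nat -> 'I_J -> R) lam k :
  ((p n)%:R : R) @[n --> \oo] --> +oo ->
  (forall n j, 0 <= q n j) ->
  (forall j, (p n)%:R * q n j @[n --> \oo] --> lam j) ->
  multinomial_pmf (q n) (p n) k @[n --> \oo] --> poisson_prod_pmf lam k.
Proof.
move=> p_oo q_ge0 ql; set K := (\sum_j k j)%N.
have psum : (p n)%:R * (\sum_j q n j) @[n --> \oo] --> \sum_j lam j.
  under eq_fun do rewrite mulr_sumr.
  by apply: (cvg_big (@add_continuous R)) => j _; exact: ql.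
have sum_ge0 n : 0 <= \sum_j q n j by exact: sumr_ge0.
have sum0 := cvg0_of_scaled p_oo psum.
have p_gt0 : \forall n \near \oo, 0 < ((p n)%:R : R) by exact: (cvgry_gt p_oo).
(* The [K] powers of [p n] are spread over the cells, so that only the products [p n * q n j] occur;
   the exponent [p n - K] becomes the full power times [K] inverse factors tending to 1. *)
pose f n : R := (p n ^_ K)%:R / (p n)%:R ^+ K *
  (\prod_j (((p n)%:R * q n j) ^+ k j / (k j)`!%:R)) *
  ((1 - \sum_j q n j) ^+ p n * \prod_(i < K) (1 - \sum_j q n j)^-1).
apply: (@cvg_trans _ (f n @[n --> \oo])).
  apply: near_eq_cvg; near=> n; rewrite /f /multinomial_pmf -/K.
  have pn0 : (p n)%:R != 0 :> R by rewrite gt_eqF//; near: n; exact: p_gt0.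
  have Kp : (K <= p n)%N.
    by rewrite -(ler_nat R); near: n; exact: (cvgry_ge p_oo).
  have r0 : 1 - \sum_j q n j != 0.
    by rewrite gt_eqF// subr_gt0; near: n; exact: (cvgr_lt _ sum0 _ ltr01).
  rewrite prodr_const card_ord -[in X in _ ^+ X * _](subnK Kp) exprD exprVn.
  rewrite mulfK ?expf_neq0//; congr (_ * _).
  rewrite (eq_bigr (fun j => (p n)%:R ^+ k j * (q n j ^+ k j / (k j)`!%:R))); last first.
    by move=> j _; rewrite exprMn mulrA.
  rewrite big_split/= prodrXr -/K.
  by rewrite mulrA divfK// expf_neq0.
have -> : poisson_prod_pmf lam k = 1 * (\prod_j (lam j ^+ k j / (k j)`!%:R)) *
    (expR (- \sum_j lam j) * \prod_(i < K) (1 - 0)^-1).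
  rewrite mul1r subr0 invr1 [X in _ * (_ * X)]big1// mulr1 -sumrN expR_sum -big_split/=.
  by apply: eq_bigr => j _; rewrite [RHS]mulrC mulrA.
apply: cvgM; last first.
  apply: cvgM; first exact: cvg_one_sub_expr.
  apply: cvg_prod_seq => i; apply: cvgV; first by rewrite subr0 oner_neq0.
  by apply: cvgB => //; exact: cvg_cst.
apply: cvgM; first exact: cvg_ffact_scaled.
apply: cvg_prod_seq => j; apply: cvgM; last exact: cvg_cst.
apply: (@cvg_comp _ _ _ _ (fun x : R => x ^+ k j) _ _ _ (ql j)).
exact: exprn_continuous.
Unshelve. all: by end_near. Qed.

End multinomial.

(** * Multinomial law of the cell counts *)

Section counts.
Context {R : realType} {d : measure_display} {T : measurableType d}.
Variable Q : probability T R.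

Lemma measure_split_bigsetU (J : nat) (E : set T) (F : 'I_J -> set T) :
  measurable E -> (forall j, measurable (F j)) -> trivIset setT F ->
  Q E = (Q (E `&` ~` (\big[setU/set0]_(j < J) F j)) + \sum_(j < J) Q (E `&` F j))%E.
Proof.
move=> mE mF tF.
have mU : measurable (\big[setU/set0]_(j < J) F j) by exact: bigsetU_measurable.
rewrite (measureDI Q mE mU) -setDE; congr (_ + _)%E.
rewrite big_distrr/= measure_bigsetU_ord//; last exact: trivIset_setIl.
by move=> j; exact: measurableI.
Qed.

Variables (Z : nat -> T -> R) (J : nat) (A : 'I_J -> set R).
Hypothesis mZ : forall i, measurable_fun setT (Z i).
Hypothesis mA : forall j, measurable (A j).
Hypothesis tA : trivIset setT A.

Definition hits (p : nat) (w : T) : {ffun 'I_J -> nat} :=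
  [ffun j => \sum_(i < p) (Z i w \in A j)]%N.

Lemma hitsS p w j : hits p.+1 w j = (hits p w j + (Z p w \in A j))%N.
Proof. by rewrite !ffunE big_ord_recr. Qed.

Lemma Z_preimage_measurable i (B : set R) : measurable B -> measurable (Z i @^-1` B).
Proof. by move=> mB; rewrite -[X in measurable X]setTI; exact: mZ. Qed.

Lemma hits_measurable p k : measurable [set w | hits p w = k].
Proof.
have -> : [set w | hits p w = k] = \bigcap_(j in [set: 'I_J]) [set w | hits p w j = k j].
  apply/seteqP; split => [w /= <- j _//|w /= wk].
  by apply/ffunP => j; exact: wk.
apply: fin_bigcap_measurable => // j _; move: (k j).
elim: p => [m|p IHp m].
  rewrite [X in measurable X](_ : _ = if m == 0%N then setT else set0); first by case: ifP.
  by apply/seteqP; split => w /=; rewrite ffunE big_ord0; case: m.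
have mB := Z_preimage_measurable p (mA j).
rewrite [X in measurable X](_ : _ =
  ([set w | hits p w j = m] `\` Z p @^-1` A j) `|`
  (if m is m'.+1 then [set w | hits p w j = m'] `&` Z p @^-1` A j else set0)).
  apply: measurableU; first exact: measurableD.
  by case: m => // m'; exact: measurableI.
apply/seteqP; split => w /=; rewrite hitsS.
  have [ZA|nZA] := pselect (A j (Z p w)).
    by rewrite (mem_set ZA) addn1 => <-; right.
  by rewrite (memNset nZA) addn0 => ->; left.
move=> [[<- nZA]|].
  by rewrite (memNset nZA) addn0.
by case: m => // m' /= [<- ZA]; rewrite (mem_set ZA) addn1.
Qed.

Variable q : 'I_J -> R.
Hypothesis indepZ : mutually_independent Q Z.
Hypothesis Zq : forall i j, Q (Z i @^-1` A j) = (q j)%:E.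

Lemma trivIset_Z_preimage i : trivIset setT (fun j => Z i @^-1` A j).
Proof. by move=> j l _ _ [w [/= Aj Al]]; apply: tA => //; exists (Z i w). Qed.

Lemma Z_outside i : Q (Z i @^-1` ~` \big[setU/set0]_(j < J) A j) = (1 - \sum_j q j)%:E.
Proof.
have mU : measurable (\big[setU/set0]_(j < J) A j) by exact: bigsetU_measurable.
have := measure_split_bigsetU measurableT (fun j => Z_preimage_measurable i (mA j))
  (@trivIset_Z_preimage i).
rewrite setTI probability_setT; under [in X in _ + X]eq_bigr do rewrite setTI Zq.
rewrite preimage_setC -(big_morph _ (preimage_setU (Z i)) (preimage_set0 (Z i))).
rewrite sumEFin => /eqP; rewrite eq_sym => /eqP.
set a := Q _; have : a \is a fin_num.
  by apply: fin_num_measure; apply: measurableC; exact: Z_preimage_measurable.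
by case: a => // r _; rewrite -EFinD => -[<-]; rewrite addrK.
Qed.

(* The events on later trials are what an induction on [p] needs: splitting
   according to the class of trial [p] moves it into that family. *)
Lemma hits_prob_tail p k (l : seq nat) (B : nat -> set R) :
  uniq l -> (forall i, i \in l -> (p <= i)%N) -> (forall i, measurable (B i)) ->
  Q ([set w | hits p w = k] `&` \bigcap_(i in [set` l]) (Z i @^-1` B i)) =
  ((multinomial_pmf q p k)%:E * \prod_(i <- l) Q (Z i @^-1` B i))%E.
Proof.
elim: p k l B => [|p IHp] k l B ul lp mB.
  rewrite multinomial_pmf0; have [->|k0] := eqVneq k.
    rewrite mul1e -indepZ//; congr (Q _); rewrite -[RHS]setTI; congr (_ `&` _).
    by apply/seteqP; split => // w _ /=; apply/ffunP => j; rewrite !ffunE big_ord0.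
  rewrite mul0e [X in Q X](_ : _ = set0) ?measure0//.
  apply/seteqP; split => // w [/= wk _]; move/eqP: k0; apply; rewrite -wk.
  by apply/ffunP => j; rewrite !ffunE big_ord0.
have pl : p \notin l by apply/negP => /lp; rewrite ltnn.
set V := \bigcap_(i in [set` l]) _.
have mV : measurable V.
  by apply: fin_bigcap_measurable => // i _; exact: Z_preimage_measurable.
(* Trial [p] joins the family with target [C]; the induction hypothesis applies to [p :: l]. *)
have step k' (C : set R) : measurable C ->
    Q ([set w | hits p w = k'] `&` Z p @^-1` C `&` V) =
    ((multinomial_pmf q p k')%:E * (Q (Z p @^-1` C) * \prod_(i <- l) Q (Z i @^-1` B i)))%E.
  move=> mC; pose B' i := if i == p then C else B i.
  have := IHp k' (p :: l) B'; rewrite /= pl ul => /(_ isT).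
  have eB' i : i \in l -> B' i = B i by rewrite /B'; case: eqVneq => // -> /(negP pl).
  have B'p : B' p = C by rewrite /B' eqxx.
  rewrite big_cons B'p.
  rewrite (eq_big_seq (fun i => Q (Z i @^-1` B i))); last by move=> i /eB' ->.
  move=> <-; first last.
  - by move=> i; rewrite /B'; case: ifP.
  - by move=> i; rewrite inE => /orP[/eqP->//|/lp /ltnW].
  rewrite -setIA; congr (Q (_ `&` _)); apply/seteqP; split => w /=.
    move=> [wC wV] i /=; rewrite inE => /orP[/eqP ->|il]; first by rewrite B'p.
    by rewrite eB'//; exact: wV.
  move=> wB; split; first by have := wB p; rewrite /= inE eqxx B'p; apply.
  by move=> i /= il; have := wB i; rewrite /= inE il orbT eB'//; apply.
have mU : measurable (\big[setU/set0]_(j < J) A j) by exact: bigsetU_measurable.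
rewrite (measure_split_bigsetU _ (fun j => Z_preimage_measurable p (mA j))
  (@trivIset_Z_preimage p)); last by apply: measurableI => //; exact: hits_measurable.
rewrite (_ : Q _ = Q ([set w | hits p w = k] `&`
    Z p @^-1` (~` \big[setU/set0]_(j < J) A j) `&` V)); last first.
  rewrite -(big_morph _ (preimage_setU (Z p)) (preimage_set0 (Z p))) -preimage_setC.
  rewrite setIAC; congr (Q (_ `&` _)); apply/seteqP; split => w [/= wk wA]; split => //=.
    rewrite -wk; apply/ffunP => j; rewrite hitsS memNset ?addn0// => Aj.
    by apply: wA; rewrite -bigcup_seq; exists j => //=; rewrite mem_index_enum.
  rewrite -wk; apply/ffunP => j; rewrite hitsS memNset ?addn0// => Aj.
  by apply: wA; rewrite -bigcup_seq; exists j => //=; rewrite mem_index_enum.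
rewrite step; last exact: measurableC.
rewrite Z_outside multinomial_pmfS.
(* If trial [p] falls in cell [j], the earlier ones must have produced [dec_ffun k j]; this is
   impossible when [k j = 0], hence the zero branch. *)
have term j : Q ([set w | hits p.+1 w = k] `&` V `&` Z p @^-1` A j) =
    ((if (0 < k j)%N then q j * multinomial_pmf q p (dec_ffun k j) else 0)%:E *
     \prod_(i <- l) Q (Z i @^-1` B i))%E.
  case: ifPn => kj; last first.
    rewrite mul0e [X in Q X](_ : _ = set0) ?measure0//; apply/seteqP; split => //.
    move=> w [[/= wk _] ZA]; move: kj; rewrite -wk hitsS (mem_set ZA).
    by rewrite addn1.
  rewrite EFinM -muleA [RHS]muleCA -(Zq p j) -step//; congr (Q _).
  rewrite setIAC; congr (_ `&` _); apply/seteqP; split => w [/= wk ZA]; split => //=.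
    apply/ffunP => i; rewrite [RHS]ffunE -wk hitsS.
    have [->|ij] := eqVneq i j; first by rewrite (mem_set ZA) addnK.
    rewrite memNset ?addn0 ?subn0// => Ai; move/eqP: ij; apply.
    by apply: tA => //; exists (Z p w).
  apply/ffunP => i; rewrite hitsS wk ffunE.
  have [->|ij] := eqVneq i j; first by rewrite (mem_set ZA) subnK.
  rewrite memNset ?addn0 ?subn0// => Ai; move/eqP: ij; apply.
  by apply: tA => //; exists (Z p w).
rewrite (eq_bigr _ (fun j _ => term j)).
have pV : (\prod_(i <- l) Q (Z i @^-1` B i))%E \is a fin_num.
  rewrite -indepZ//; exact: fin_num_measure.
rewrite -(fineK pV) -!EFinM; under eq_bigr do rewrite -EFinM.
rewrite sumEFin -EFinD; congr _%:E.
rewrite -mulr_suml -big_mkcond/=; ring.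
Qed.

Lemma hits_prob p k : Q [set w | hits p w = k] = (multinomial_pmf q p k)%:E.
Proof.
have := @hits_prob_tail p k [::] (fun=> setT) isT.
rewrite big_nil mule1 => <- //; congr (Q _).
by rewrite (_ : [set` _] = set0) ?bigcap_set0 ?setIT//; apply/seteqP; split.
Qed.

End counts.

(** * Expectations of functions of countably valued random elements *)

Section discrete.
Context {R : realType} {V : countType}.

Lemma measurable_comp_countType {d d'} {T : measurableType d} {W : measurableType d'}
  (K : T -> V) (h : V -> W) :
  (forall v, measurable [set w | K w = v]) -> measurable_fun setT (h \o K).
Proof.
move=> mK _ B mB; rewrite setTI.
rewrite [X in measurable X](_ : _ = \bigcup_v [set w | K w = v /\ B (h v)]).
  apply: countable_bigcupT_measurable => [|v]; first exact: countableP.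
  have [Bv|nBv] := pselect (B (h v)).
    by rewrite [X in measurable X](_ : _ = [set w | K w = v])//; apply/seteqP; split => w //= [].
  by rewrite [X in measurable X](_ : _ = set0)//; apply/seteqP; split => w //= [].
by apply/seteqP; split => [w /= Bw|w /= [v _ [<-]]//]; exists (K w).
Qed.

(** Coding values by naturals turns expectations into ordinary series; an index that codes no value
    weighs 0. *)
Definition weight {d} {T : measurableType d} (P : probability T R)
    (K : T -> V) (phi : V -> R) (i : nat) : R :=
  oapp (fun v => phi v * fine (P [set w | K w = v])) 0 (pickle_inv i).

Lemma weight_ge0 {d} {T : measurableType d} (P : probability T R)
    (K : T -> V) (phi : V -> R) i :
  (forall v, 0 <= phi v) -> 0 <= weight P K phi i.
Proof. by rewrite /weight; case: pickle_inv => //= v phi0; rewrite mulr_ge0// fine_ge0. Qed.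

(** The fibres of [pickle \o K] partition the space, and the integrand is constant on each. *)
Lemma discrete_expectation {d} {T : measurableType d} (P : probability T R)
  (K : T -> V) (phi : V -> R) :
  (forall v, measurable [set w | K w = v]) -> (forall v, 0 <= phi v) ->
  (\int[P]_w (phi (K w))%:E = \sum_(i <oo) (weight P K phi i)%:E)%E.
Proof.
move=> mK phi_ge0.
pose F i := [set w | pickle (K w) = i].
have FE i : F i = oapp (fun v => [set w | K w = v]) set0 (pickle_inv i).
  apply/seteqP; split => w; rewrite /F /=; first by move=> <-; rewrite pickleK_inv.
  by case: (pickle_inv i) (@pickle_invK V i) => [v /= <- ->|].
have mF i : measurable (F i).
  by rewrite FE; case: pickle_inv => //= v; exact: mK.
have UF : \bigcup_i F i = setT.
  by apply/seteqP; split => // w _; exists (pickle (K w)).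
rewrite -UF ge0_integral_bigcup//; first last.
- by apply/trivIsetP => i j _ _ ij; apply/seteqP; split => // w [/= wi wj]; move/eqP: ij; apply; rewrite -wi -wj.
- by move=> w _; rewrite lee_fin.
- rewrite UF; exact: (@measurable_comp_countType _ _ _ _ K (EFin \o phi)).
apply: eq_eseriesr => i _; rewrite FE /weight.
case: pickle_inv => [v|] /=; last by rewrite integral_set0.
rewrite (eq_integral (cst (phi v)%:E)) ?integral_cst//.
  by rewrite EFinM fineK// fin_num_measure.
by move=> w; rewrite inE /= => ->.
Qed.

(* Fatou's lemma for the counting measure on the values. *)
Lemma discrete_fatou {d2 d3} {T2 : measurableType d2} {T3 : measurableType d3}
  (Q2 : probability T2 R) (Q3 : probability T3 R)
  (Kn : nat -> T2 -> V) (K : T3 -> V) (phi : V -> R) (a : R) :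
  (forall n v, measurable [set w | Kn n w = v]) ->
  (forall v, measurable [set w | K w = v]) -> (forall v, 0 <= phi v) ->
  (forall v, fine (Q2 [set w | Kn n w = v]) @[n --> \oo] --> fine (Q3 [set w | K w = v])) ->
  (a%:E < \int[Q3]_w (phi (K w))%:E)%E ->
  \forall n \near \oo, (a%:E < \int[Q2]_w (phi (Kn n w))%:E)%E.
Proof.
move=> mKn mK phi_ge0 QQ; rewrite discrete_expectation// => aK.
(* Some finite partial sum already exceeds [a], and a finite sum passes to the limit in [n]; the
   discarded terms are nonnegative. *)
have [M aM] : exists M, a < \sum_(0 <= i < M) weight Q3 K phi i.
  apply: contrapT => noM; move: aK; apply/negP; rewrite -leNgt.
  apply: lime_le; first by apply: is_cvg_nneseries => i _ _; rewrite lee_fin weight_ge0.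
  apply: nearW => M; rewrite sumEFin lee_fin leNgt; apply/negP => aM.
  by apply: noM; exists M.
have cvgM_ : \sum_(0 <= i < M) weight Q2 (Kn n) phi i @[n --> \oo] -->
             \sum_(0 <= i < M) weight Q3 K phi i.
  apply: (cvg_big (@add_continuous R)) => i _; rewrite /weight.
  case: pickle_inv => [v|] /=; last exact: cvg_cst.
  by apply: cvgM; [exact: cvg_cst | exact: QQ].
near=> n; rewrite discrete_expectation//.
apply: (@lt_le_trans _ _ (\sum_(0 <= i < M) weight Q2 (Kn n) phi i)%:E).
  by rewrite lte_fin; near: n; exact: (cvgr_gt _ cvgM_).
rewrite -sumEFin; apply: nneseries_lim_ge => i _ _.
by rewrite lee_fin weight_ge0.
Unshelve. all: by end_near. Qed.

End discrete.

(** * Grids and vague convergence *)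

Section grid.
Context {R : realType}.
Implicit Types (m j : nat) (x : R).

(** Mesh [1 / (m + 1)] on the window from [-m] to [m]: the integers in the window are grid points,
    and [m.+1] avoids a zero denominator. *)
Definition grid m j : R := - m%:R + j%:R / m.+1%:R.
Definition cell m j : set R := `]grid m j, grid m j.+1]%classic.
Definition ncells m : nat := (2 * m * m.+1)%N.

Lemma gridS m j : grid m j.+1 = grid m j + m.+1%:R^-1.
Proof. by rewrite /grid -addrA -[j.+1]addn1 natrD mulrDl mul1r. Qed.

Lemma grid_le m j l : (j <= l)%N -> grid m j <= grid m l.
Proof. by move=> jl; rewrite lerD2l ler_pM2r ?invr_gt0// ler_nat. Qed.

Lemma grid_ncells m : grid m (ncells m) = m%:R.
Proof.
rewrite /grid /ncells [X in X%:R / _]mulnC natrM mulrAC mulfV// mul1r natrM.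
by rewrite mulr_natl mulr2n addKr.
Qed.

Lemma grid_subn m k : (k <= m)%N -> grid m ((m - k) * m.+1) = - k%:R.
Proof. by move=> km; rewrite /grid natrM mulfK// natrB//; ring. Qed.

Lemma grid_addn m k : grid m ((m + k) * m.+1) = k%:R.
Proof. by rewrite /grid natrM mulfK// natrD; ring. Qed.

Lemma measurable_cell m j : measurable (cell m j).
Proof. exact: measurable_itv. Qed.

Lemma cell_inj m j l x : cell m j x -> cell m l x -> j = l.
Proof.
rewrite /cell /= !in_itv /= => /andP[jx xj] /andP[lx xl].
have [lj|jl|//] := ltngtP l j.
  by have := lt_le_trans jx (le_trans xl (grid_le m lj)); rewrite ltxx.
by have := lt_le_trans lx (le_trans xj (grid_le m jl)); rewrite ltxx.
Qed.

Lemma trivIset_cell_ord m J : trivIset setT (fun j : 'I_J => cell m j).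
Proof. by move=> j l _ _ [x [jx lx]]; apply/val_inj/(cell_inj jx lx). Qed.

Lemma mem_cell m J x : grid m 0 < x -> x <= grid m J -> exists j : 'I_J, cell m j x.
Proof.
move=> x0; elim: J => [xJ|J IHJ xJ]; first by have := lt_le_trans x0 xJ; rewrite ltxx.
have [/IHJ[j jx]|Jx] := leP x (grid m J); first by exists (widen_ord (leqnSn J) j).
by exists ord_max; rewrite /cell /= in_itv /= Jx.
Qed.

Lemma cell_compact_sub m j : exists2 K : set R, compact K & cell m j `<=` K.
Proof.
exists `[grid m j, grid m j.+1]%classic; first exact: segment_compact.
by move=> x; rewrite /cell /= !in_itv/= => /andP[/ltW -> ->].
Qed.

Lemma measure_cells (nu : {measure set R -> \bar R}) m a b : (a <= b)%N ->
  nu `]grid m a, grid m b]%classic = (\sum_(a <= j < b) nu (cell m j))%E.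
Proof.
elim: b => [|b IHb]; first by rewrite leqn0 => /eqP ->; rewrite big_geq// set_itvoc0// measure0.
rewrite leq_eqVlt => /predU1P[->|]; first by rewrite big_geq// set_itvoc0// measure0.
rewrite ltnS => ab; rewrite big_nat_recr//= -IHb//.
rewrite -measureU//.
- congr (nu _); apply/seteqP; split => x; rewrite /cell /= !in_itv/=.
    move=> /andP[ax xb]; have [xb'|bx] := leP x (grid m b); first by left; rewrite ax.
    by right.
  move=> [/andP[-> /le_trans]|/andP[bx ->]]; first by apply; exact: grid_le.
  by rewrite (le_lt_trans _ bx)//; exact: grid_le.
- exact: measurable_cell.
- apply/seteqP; split => // x; rewrite /cell /= !in_itv/= => -[/andP[_ xb] /andP[bx _]].
  by have := lt_le_trans bx xb; rewrite ltxx.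
Qed.

Definition same_counts m (nu mu : {measure set R -> \bar R}) : Prop :=
  forall j : 'I_(ncells m), nu (cell m j) = mu (cell m j).

(** The integer endpoints are grid points, so the window is a union of cells. This fixes the window
    mass that appears in the error bounds. *)
Lemma same_counts_window m nu mu (k : nat) : (k <= m)%N -> same_counts m nu mu ->
  nu `](- k%:R), k%:R]%classic = mu `](- k%:R), k%:R]%classic.
Proof.
move=> km nm; rewrite -(grid_subn km) -(grid_addn m k).
have ab : ((m - k) * m.+1 <= (m + k) * m.+1)%N.
  by rewrite leq_mul2r orbC (leq_trans (leq_subr _ _))// leq_addr.
rewrite !measure_cells//; apply: eq_big_nat => j /andP[_ jb].
have jn : (j < ncells m)%N.
  by rewrite (leq_trans jb)// leq_mul2r orbC mul2n -addnn leq_add2l km.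
exact: (nm (Ordinal jn)).
Qed.

(** Compactness gives one mesh size for all [x] in [[-(K+1), K+1]]. For other [x], the mesh being at
    most 1, both [x] and [y] lie outside [[-K, K]], where [f] vanishes. *)
Lemma uniform_mesh (f : R -> R) (K : nat) (e : R) :
  continuous f -> (forall x, K%:R < `|x| -> f x = 0) -> 0 < e ->
  \forall m \near \oo, forall x y : R, `|x - y| <= m.+1%:R^-1 -> `|f x - f y| <= e.
Proof.
move=> cf f0 e0.
pose P m x := forall y : R, `|x - y| <= m.+1%:R^-1 -> `|f x - f y| <= e.
have cpt : compact `[(- K.+1%:R : R), K.+1%:R]%classic by exact: segment_compact.
have := (compact_near_coveringP _).1 cpt nat \oo P _.
have cov : forall x, `[(- K.+1%:R : R), K.+1%:R]%classic x ->
    \forall x' \near x & m \near \oo, P m x'.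
  move=> x _; have e20 : 0 < e / 2 by rewrite divr_gt0.
  have /cvgrPdist_le/(_ _ e20)/nbhs_ballP[r /= r0 xr] := cf x.
  (* Half of the radius is spent on [x'] and half on the mesh, which keeps [y] in the ball around
     [x]. *)
  have mr : \forall m \near \oo, m.+1%:R^-1 < r / 2.
    have r20 : 0 < r / 2 by rewrite divr_gt0.
    exact: (near_infty_natSinv_lt (PosNum r20)).
  exists (ball x (r / 2), [set m | m.+1%:R^-1 < r / 2]).
    by split => //=; apply: nbhsx_ballx; rewrite divr_gt0.
  move=> [x' m] [/= xx' mr'] y x'y; rewrite /ball/= in xx'.
  have h1 := xr x'; have h2 := xr y; rewrite /ball/= in h1 h2.
  have := h1 _; have := h2 _ => h3 h4.
  have {}h4 : `|f x - f x'| <= e / 2 by apply: h4; lra.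
  have {}h3 : `|f x - f y| <= e / 2.
    apply: h3; have := ler_distD x' x y; have := le_lt_trans x'y mr'; lra.
  by have := ler_distD (f x) (f x') (f y); rewrite (distrC (f x') (f x)); lra.
move=> /(_ _ cov) near_in; near=> m => x y xy.
have [xK|Kx] := leP `|x| K.+1%:R.
  have := near near_in m => /(_ _)/(_ x); apply => //.
  by rewrite /= in_itv/= -ler_norml.
have m1 : (m.+1%:R^-1 : R) <= 1 by rewrite invf_le1// ler1n.
have Ky : K%:R < `|y|.
  have := le_trans xy m1; have := lerB_dist x y; have : (K.+1%:R : R) = K%:R + 1 by rewrite -natr1.
  lra.
by rewrite !f0 ?subrr ?normr0 ?ltW//; apply: lt_trans Kx; rewrite ltr_nat.
Unshelve. all: by end_near. Qed.

End grid.

(** * Step-function approximation of integrals, and vague convergence *)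

Section vague.
Context {R : realType}.

(** A Riemann sum at right endpoints: it sees [nu] only through its values on the cells. *)
Definition step_sum (f : R -> R) m (nu : {measure set R -> \bar R}) : \bar R :=
  (\sum_(j < ncells m) (f (grid m j.+1))%:E * nu (cell m j))%E.

Definition step_fun (f : R -> R) m (x : R) : R :=
  \sum_(j < ncells m) f (grid m j.+1) * \1_(cell m j) x.

Lemma step_funE f m (j : 'I_(ncells m)) x : cell m j x -> step_fun f m x = f (grid m j.+1).
Proof.
move=> jx; rewrite /step_fun (bigD1 j)//= indicE mem_set// mulr1 big1 ?addr0// => l lj.
rewrite indicE memNset ?mulr0// => lx.
by move/eqP: lj; apply; exact/val_inj/(cell_inj lx jx).
Qed.

Lemma integral_step_fun f m (nu : {measure set R -> \bar R}) :
  (forall x, 0 <= f x) -> (\int[nu]_x (step_fun f m x)%:E)%E = step_sum f m nu.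
Proof.
move=> f_ge0; rewrite /step_fun /step_sum.
under eq_integral do rewrite -sumEFin.
have mI (j : 'I_(ncells m)) : measurable_fun setT (EFin \o (\1_(cell m j) : R -> R)).
  apply/measurable_EFinP; apply: measurable_indic; exact: measurable_cell.
rewrite (ge0_integral_sum _ measurableT); first last.
- by move=> j x _; rewrite lee_fin mulr_ge0.
- move=> j; apply/measurable_EFinP/measurable_funM => //.
  by apply: measurable_indic; exact: measurable_cell.
apply: eq_bigr => j _; under eq_integral do rewrite EFinM.
rewrite (ge0_integralZl_EFin _ measurableT)//; last exact: mI.
by rewrite integral_indic ?setIT//; exact: measurable_cell.
Qed.

Section step_bounds.
Variables (f : R -> R) (m k : nat) (e : R) (nu : {measure set R -> \bar R}).
Hypothesis cf : continuous f.
Hypothesis f_ge0 : forall x, 0 <= f x.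
Hypothesis f0 : forall x, k%:R < `|x| -> f x = 0.
Hypothesis km : (k < m)%N.
Hypothesis e_ge0 : 0 <= e.
Hypothesis f_mesh : forall x y : R, `|x - y| <= m.+1%:R^-1 -> `|f x - f y| <= e.

(** One unit wider than [[-k, k]]: the mesh is at most 1, so for [x] outside [D] the right endpoint
    of its cell is still outside [[-k, k]], and [f] vanishes at both points. *)
Let D : set R := `](- k.+1%:R), k.+1%:R]%classic.

Lemma step_fun_ge0 x : 0 <= step_fun f m x.
Proof. by apply: sumr_ge0 => j _; rewrite mulr_ge0. Qed.

Lemma dist_step_fun x : `|f x - step_fun f m x| <= e * \1_D x.
Proof.
have kS : (k.+1%:R : R) = k%:R + 1 by rewrite -natr1.
have m1 : (m.+1%:R^-1 : R) <= 1 by rewrite invf_le1// ler1n.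
have [[j jx]|nx] := pselect (exists j : 'I_(ncells m), cell m j x).
  rewrite (step_funE f jx); move: jx; rewrite /cell /= in_itv/= gridS => /andP[gx].
  have fm := f_mesh; move: m1 fm; move: (m.+1%:R^-1) => dl dl1 fm xg.
  rewrite indicE; have [xD|xD] := boolP (x \in D).
    rewrite mulr1; apply: fm; rewrite ler_norml; apply/andP; split; lra.
  rewrite mulr0.
  have kx : k%:R < `|x| /\ k%:R < `|grid m j + dl|.
    have nD : ~ D x by move=> /mem_set; rewrite (negPf xD).
    have [xk|xk] := leP x (- k.+1%:R).
      by split; rewrite ltr_normr; apply/orP; right; lra.
    have [xk'|xk'] := leP x k.+1%:R.
      by exfalso; apply: nD; rewrite /D /= in_itv/= xk xk'.
    by split; rewrite ltr_normr; apply/orP; left; lra.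
  by rewrite !f0 ?subrr ?normr0//; case: kx.
(* A point in no cell lies outside []-m, m]], and [k < m] makes [f] vanish there too. *)
have -> : step_fun f m x = 0.
  apply: big1 => j _; rewrite indicE memNset ?mulr0// => jx.
  by apply: nx; exists j.
rewrite f0 ?subrr ?normr0 ?mulr_ge0//.
rewrite ltNge; apply/negP; rewrite ler_norml => /andP[xk xk']; apply: nx.
have mk : (k%:R : R) + 1 <= m%:R by rewrite natr1 ler_nat.
apply: mem_cell; rewrite ?grid_ncells; last by lra.
by rewrite /grid mul0r addr0; lra.
Qed.

Let mf : measurable_fun setT (EFin \o f).
Proof. by apply/measurable_EFinP; exact: continuous_measurable_fun. Qed.

Let ms : measurable_fun setT (EFin \o step_fun f m).
Proof.
apply/measurable_EFinP; apply: measurable_sum => j; apply: measurable_funM => //.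
by apply: measurable_indic; exact: measurable_cell.
Qed.

Let mD : measurable D. Proof. exact: measurable_itv. Qed.

Lemma integral_add_indic (h : R -> R) : measurable_fun setT (EFin \o h) -> (forall x, 0 <= h x) ->
  (\int[nu]_x (h x + e * \1_D x)%:E = \int[nu]_x (h x)%:E + e%:E * nu D)%E.
Proof.
move=> mh h_ge0; under eq_integral do rewrite EFinD EFinM.
have mI : measurable_fun setT (EFin \o (\1_D : R -> R)).
  by apply/measurable_EFinP; exact: measurable_indic.
rewrite ge0_integralD//; first last.
- exact: measurable_funeM.
- by move=> x _; rewrite mule_ge0// lee_fin.
- by move=> x _; rewrite lee_fin.
by rewrite ge0_integralZl_EFin ?integral_indic ?setIT.
Qed.

Lemma integral_le_step_sum :
  (\int[nu]_x (f x)%:E <= step_sum f m nu + e%:E * nu D)%E.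
Proof.
rewrite -integral_step_fun// -integral_add_indic//; last exact: step_fun_ge0.
apply: ge0_le_integral => //.
- by move=> x _; rewrite lee_fin.
- apply/measurable_EFinP; apply: measurable_funD; first exact/measurable_EFinP.
  by apply: measurable_funM => //; exact: measurable_indic.
- by move=> x _; rewrite lee_fin; have := dist_step_fun x; rewrite ler_norml; lra.
Qed.

Lemma step_sum_le_integral :
  (step_sum f m nu <= \int[nu]_x (f x)%:E + e%:E * nu D)%E.
Proof.
rewrite -integral_step_fun// -integral_add_indic//.
apply: ge0_le_integral => //.
- by move=> x _; rewrite lee_fin step_fun_ge0.
- apply/measurable_EFinP; apply: measurable_funD; first exact/measurable_EFinP.
  by apply: measurable_funM => //; exact: measurable_indic.
- by move=> x _; rewrite lee_fin; have := dist_step_fun x; rewrite ler_norml; lra.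
Qed.

End step_bounds.

(** The integrals of [f] against [nu m] and against [mu] both lie within [e * mu D] of the same step
    sum, where [e] is arbitrarily small once the mesh is fine. *)
Lemma vague_cvg_same_counts (nu : nat -> {measure set R -> \bar R}) mu :
  radon_measure mu -> (forall m, same_counts m (nu m) mu) -> vague_cvg nu mu.
Proof.
move=> rmu nm f [cf [f_ge0 [K [cptK fK]]]].
have mu_fin (A : set R) : measurable A -> (exists2 C : set R, compact C & A `<=` C) -> mu A \is a fin_num.
  move=> mA [C cC AC]; rewrite ge0_fin_numE//; apply: le_lt_trans (rmu _ cC).
  rewrite le_measure ?inE//; apply: closed_measurable; exact: compact_closed.
have [k f0] : exists k : nat, forall x, k%:R < `|x| -> f x = 0.
  have [M [_ MK]] := compact_bounded cptK.
  (* [compact_bounded] gives bounds strictly beyond [M]: the radius [|M| + 1] is used, and the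
     chosen integer exceeds it. *)
  exists (Num.truncn `|M|).+2 => x kx; apply: fK => Kx.
  have := MK (`|M| + 1) _ _ Kx; rewrite (le_lt_trans (ler_norm _)) ?ltrDl// => /(_ isT).
  have := truncnS_gt `|M|; move: kx; rewrite -[_.+2%:R]natr1 /=; lra.
set D : set R := `](- k.+1%:R), k.+1%:R]%classic.
have Dfin : mu D \is a fin_num.
  apply: mu_fin; first exact: measurable_itv.
  exists `[(- k.+1%:R : R), k.+1%:R]%classic; first exact: segment_compact.
  by move=> x; rewrite /D /= !in_itv/= => /andP[/ltW -> ->].
have ssum m : step_sum f m (nu m) = step_sum f m mu.
  by apply: eq_bigr => j _; rewrite nm.
have sfin m : step_sum f m mu \is a fin_num.
  apply/sum_fin_numP => j _ _; rewrite fin_numM//.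
  by apply: mu_fin; [exact: measurable_cell | exact: cell_compact_sub].
have Dnu m : (k < m)%N -> nu m D = mu D by move=> km; exact: (same_counts_window km).
have If_ge0 (n : {measure set R -> \bar R}) : (0 <= \int[n]_x (f x)%:E)%E.
  by apply: integral_ge0 => x _; rewrite lee_fin.
(* Stated for any measure sharing the step sum and window mass of [mu], so as to serve for [mu]
   itself and for [nu m]. *)
have approx e m (n : {measure set R -> \bar R}) : 0 <= e -> (k < m)%N ->
    (forall x y : R, `|x - y| <= m.+1%:R^-1 -> `|f x - f y| <= e) ->
    step_sum f m n = step_sum f m mu -> n D = mu D ->
    (\int[n]_x (f x)%:E)%E \is a fin_num /\
    `|fine (\int[n]_x (f x)%:E) - fine (step_sum f m mu)| <= e * fine (mu D).
  move=> e0 km fm ns nD.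
  have upper := integral_le_step_sum n cf f_ge0 f0 km e0 fm.
  have lower := step_sum_le_integral n cf f_ge0 f0 km e0 fm.
  move: upper lower; rewrite -/D ns nD -(fineK (sfin m)) -(fineK Dfin) -EFinM -EFinD /=.
  case: (\int[n]_x _)%E (If_ge0 n) => //= i _.
  by rewrite -EFinD !lee_fin => il ir; split => //; rewrite ler_norml; lra.
have approx_mu e m : 0 <= e -> (k < m)%N ->
    (forall x y : R, `|x - y| <= m.+1%:R^-1 -> `|f x - f y| <= e) ->
    (\int[mu]_x (f x)%:E)%E \is a fin_num /\
    `|fine (\int[mu]_x (f x)%:E) - fine (step_sum f m mu)| <= e * fine (mu D).
  by move=> e0 km fm; exact: approx.
have approx_nu e m : 0 <= e -> (k < m)%N ->
    (forall x y : R, `|x - y| <= m.+1%:R^-1 -> `|f x - f y| <= e) ->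
    (\int[nu m]_x (f x)%:E)%E \is a fin_num /\
    `|fine (\int[nu m]_x (f x)%:E) - fine (step_sum f m mu)| <= e * fine (mu D).
  by move=> e0 km fm; apply: approx => //; exact: Dnu.
have gtk : \forall m \near \oo, (k < m)%N by exact: nbhs_infty_gt.
have mesh e (e0 : 0 < e) := uniform_mesh cf f0 e0.
have Imu : (\int[mu]_x (f x)%:E)%E \is a fin_num.
  have [m [km fm]] := filter_ex (filterI gtk (mesh 1 ltr01)).
  by have [] := approx_mu 1 m ler01 km fm.
rewrite -(fineK Imu); apply/fine_cvgP; split.
  near=> m; have km : (k < m)%N by near: m.
  have fm : forall x y : R, `|x - y| <= m.+1%:R^-1 -> `|f x - f y| <= 1.
    by near: m; exact: (mesh 1 ltr01).
  by have [] := approx_nu 1 m ler01 km fm.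
apply/cvgrPdist_le => e e0; set c := fine (mu D).
have c_ge0 : 0 <= c by exact: fine_ge0.
(* The [+ 1] guards against [mu D = 0]; the factor 2 pays for the two approximations. *)
pose e' := e / (2 * (c + 1)).
have e'0 : 0 < e' by rewrite divr_gt0// mulr_gt0// ltr_wpDl.
have e'c : 2 * (e' * c) <= e.
  rewrite [leLHS](_ : _ = e * (c / (c + 1))); last first.
    by rewrite /e'; field; rewrite gt_eqF// ltr_wpDl.
  by rewrite ger_pMr// ler_pdivrMr ?mul1r ?ltr_wpDl// lerDl.
near=> m; have km : (k < m)%N by near: m.
have fm : forall x y : R, `|x - y| <= m.+1%:R^-1 -> `|f x - f y| <= e'.
  by near: m; exact: mesh.
have [_ h1] := approx_mu _ _ (ltW e'0) km fm.
have [_ h2] := approx_nu _ _ (ltW e'0) km fm.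
rewrite /=; move: h1 h2; rewrite -/c !ler_norml => /andP[? ?] /andP[? ?].
apply/andP; split; lra.
Unshelve. all: by end_near. Qed.

End vague.

(** * Lower envelopes of vaguely continuous functions *)

Section lower_envelope.
Context {R : realType}.
Local Notation M_ := {measure set R -> \bar R}.
Implicit Types (nu mu : M_) (g : M_ -> R).

Definition cell_counts m nu : {ffun 'I_(ncells m) -> nat} :=
  [ffun j : 'I_(ncells m) => Num.truncn (fine (nu (cell m j)))].

(** An infinite value is impossible because the cell lies in a compact set of finite mass; hence
    [truncn] and [fine] lose nothing. *)
Lemma cell_countsE m nu (j : 'I_(ncells m)) : point_measure nu ->
  nu (cell m j) = (cell_counts m nu j)%:R%:E.
Proof.
move=> [rnu pnu]; rewrite ffunE; case: (pnu _ (measurable_cell m j)) => [[k ->]|nuoo].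
  by rewrite /= natrK.
have [K cK jK] := @cell_compact_sub R m j.
have : (nu (cell m j) <= nu K)%E.
  rewrite le_measure ?inE//; first exact: measurable_cell.
  by apply: closed_measurable; exact: compact_closed.
by rewrite nuoo leye_eq => /eqP nuK; have := rnu _ cK; rewrite nuK ltxx.
Qed.

Lemma same_counts_cell_counts m nu mu : point_measure nu -> point_measure mu ->
  cell_counts m nu = cell_counts m mu -> same_counts m nu mu.
Proof. by move=> pnu pmu e j; rewrite !cell_countsE// e. Qed.

(* Sandwiching [g] from below by functions of finitely many counts replaces
   tightness and compactness arguments on the space of point measures. *)
Definition lower g m (k : {ffun 'I_(ncells m) -> nat}) : R :=
  inf [set g nu | nu in [set nu | point_measure nu /\ cell_counts m nu = k]].
Arguments lower : clear implicits.

Section lower.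
Variable g : M_ -> R.
Hypothesis g_ge0 : forall nu, point_measure nu -> 0 <= g nu.

Let lb0 m (k : {ffun 'I_(ncells m) -> nat}) :
  lbound [set g nu | nu in [set nu | point_measure nu /\ cell_counts m nu = k]] 0.
Proof. by move=> _ [nu [pnu _] <-]; exact: g_ge0. Qed.

Lemma lower_ge0 m k : 0 <= lower g m k.
Proof.
rewrite /lower; set E := (X in inf X).
(* The convention that [inf] of the empty set is 0 covers the case that no point measure has the
   counts [k]. *)
have [->|/set0P E0] := eqVneq E set0; first by rewrite inf0.
by apply: lb_le_inf => //; exact: lb0.
Qed.

Lemma lower_le m nu : point_measure nu -> lower g m (cell_counts m nu) <= g nu.
Proof.
move=> pnu; apply: ge_inf; first by exists 0; exact: lb0.
by exists nu.
Qed.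

(** Near-minimizers [nu m] with the counts of [mu] in the m-th grid converge vaguely to [mu], so
    [g (nu m)] tends to [g mu]; the envelope is squeezed between [g (nu m) - 1 / (m + 1)] and
    [g mu]. *)
Lemma cvg_lower mu : bdd_vague_continuous g -> point_measure mu ->
  lower g m (cell_counts m mu) @[m --> \oo] --> g mu.
Proof.
move=> [_ gcont] pmu.
have /choice[nu nuP] m : exists nu, [/\ point_measure nu,
    cell_counts m nu = cell_counts m mu &
    g nu < lower g m (cell_counts m mu) + m.+1%:R^-1].
  have hE : has_inf [set g nu |
      nu in [set nu | point_measure nu /\ cell_counts m nu = cell_counts m mu]].
    by split; [exists (g mu), mu | exists 0; exact: lb0].
  have m0 : 0 < m.+1%:R^-1 :> R by rewrite invr_gt0.
  by have [_ [nu [pnu numu] <-] lt] := inf_adherent m0 hE; exists nu.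
have numu : vague_cvg nu mu.
  apply: vague_cvg_same_counts; first by case: pmu.
  by move=> m; have [pnu e _] := nuP m; exact: same_counts_cell_counts.
have gnu : g (nu m) @[m --> \oo] --> g mu.
  by apply: gcont => // m; have [] := nuP m.
apply: (@squeeze_cvgr _ _ _ _ (fun m => g (nu m) - m.+1%:R^-1) (fun=> g mu)).
- apply: nearW => m; rewrite lower_le// andbT lerBlDr.
  by have [_ _ /ltW] := nuP m.
- by rewrite -[X in _ --> X]subr0; apply: cvgB => //; exact: cvg_harmonic.
- exact: cvg_cst.
Qed.

(** Measurability is not part of [bdd_vague_continuous]; it comes from the envelopes, functions of
    countably valued counts that converge pointwise to [g]. *)
Lemma measurable_vague_continuous {d} {T : measurableType d} (N : T -> M_) :
  bdd_vague_continuous g -> (forall w, point_measure (N w)) ->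
  (forall m k, measurable [set w | cell_counts m (N w) = k]) ->
  measurable_fun setT (g \o N).
Proof.
move=> gcont pN mN.
apply: (@measurable_fun_cvg _ _ _ _ (fun m w => lower g m (cell_counts m (N w)))).
  move=> m; exact: (@measurable_comp_countType _ _ _ _ _ (fun w => cell_counts m (N w)) (lower g m) (mN m)).
by move=> w _; exact: cvg_lower.
Qed.

(** Dominated convergence fixes one grid on which the envelope already has expectation above [a];
    Fatou for the counts in that grid and [lower_le] conclude. *)
Lemma liminf_vague_continuous {d2 d3} {T2 : measurableType d2} {T3 : measurableType d3}
    (Q2 : probability T2 R) (Q3 : probability T3 R)
    (Nn : nat -> T2 -> M_) (N : T3 -> M_) (a : R) :
  bdd_vague_continuous g ->
  (forall n w, point_measure (Nn n w)) -> (forall w, point_measure (N w)) ->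
  (forall n m k, measurable [set w | cell_counts m (Nn n w) = k]) ->
  (forall m k, measurable [set w | cell_counts m (N w) = k]) ->
  (forall m k, fine (Q2 [set w | cell_counts m (Nn n w) = k]) @[n --> \oo] -->
     fine (Q3 [set w | cell_counts m (N w) = k])) ->
  (a%:E < \int[Q3]_w (g (N w))%:E)%E ->
  \forall n \near \oo, (a%:E < \int[Q2]_w (g (Nn n w))%:E)%E.
Proof.
move=> gcont pNn pN mNn mN QQ aN.
have [M gM] := gcont.1.
have mlow m : measurable_fun setT (fun w => (lower g m (cell_counts m (N w)))%:E).
  exact: (@measurable_comp_countType _ _ _ _ _ (fun w => cell_counts m (N w)) (EFin \o lower g m) (mN m)).
have lowN : (\int[Q3]_w (lower g m (cell_counts m (N w)))%:E)%E @[m --> \oo] -->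
            (\int[Q3]_w (g (N w))%:E)%E.
  apply: (@dominated_cvg _ _ _ _ _ measurableT _ _ (cst M%:E)) => //.
  - by move=> w _; apply: cvg_EFin; [exact: nearW | exact: cvg_lower].
  - exact: finite_measure_integrable_cst.
  - move=> m w _; rewrite /= lee_fin ger0_norm ?lower_ge0//.
    rewrite (le_trans (lower_le m (pN w)))// (le_trans (ler_norm _))//.
    exact: gM.
have [m am] : exists m, (a%:E < \int[Q3]_w (lower g m (cell_counts m (N w)))%:E)%E.
  apply: contrapT => noM; move: aN; apply/negP; rewrite -leNgt.
  apply: (cvge_to_le lowN); apply: nearW => m; rewrite leNgt; apply/negP => am.
  by apply: noM; exists m.
have := discrete_fatou (fun n => mNn n m) (mN m) (@lower_ge0 m) (QQ m) am.
apply: filterS => n /lt_le_trans; apply; apply: ge0_le_integral => //.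
- by move=> w _; rewrite lee_fin lower_ge0.
- exact: (@measurable_comp_countType _ _ _ _ _ (fun w => cell_counts m (Nn n w)) (EFin \o lower g m) (mNn n m)).
- by apply/measurable_EFinP; apply: (measurable_vague_continuous gcont (pNn n)) => m' k; exact: mNn.
- by move=> w _; rewrite lee_fin lower_le.
Qed.

End lower.

Lemma integral_bounded {d} {T : measurableType d} (P : probability T R) (h : T -> R) (M : R) :
  measurable_fun setT h -> (forall w, `|h w| <= M) ->
  exists r : R, [/\ (\int[P]_w (h w)%:E = r%:E)%E,
    (\int[P]_w (M + h w)%:E = (M + r)%:E)%E & (\int[P]_w (M - h w)%:E = (M - r)%:E)%E].
Proof.
move=> mh hM.
have ih : P.-integrable setT (EFin \o h).
  apply: measurable_bounded_integrable => //.
    by apply: (le_lt_trans (probability_le1 P measurableT)); rewrite ltry.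
  exists M; split; first exact: num_real.
  by move=> x Mx w _ /=; rewrite (le_trans (hM w))// ltW.
have iM : P.-integrable setT (EFin \o cst M) by exact: finite_measure_integrable_cst.
have PM : (\int[P]_w M%:E = M%:E)%E.
  rewrite (@integral_cst _ _ _ P setT measurableT M%:E) -[RHS]mule1.
  by congr (_ * _)%E; exact: probability_setT.
exists (fine (\int[P]_w (h w)%:E)).
have fh : (\int[P]_w (h w)%:E)%E \is a fin_num by exact: integrable_fin_num.
split; first by rewrite fineK.
- under eq_integral do rewrite EFinD.
  by rewrite integralD//= PM EFinD fineK.
- under eq_integral do rewrite EFinB.
  by rewrite integralB//= PM EFinB fineK.
Qed.

Lemma bdd_vague_continuous_shift g (M : R) : bdd_vague_continuous g ->
  bdd_vague_continuous (fun nu => M + g nu) /\ bdd_vague_continuous (fun nu => M - g nu).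
Proof.
move=> [[B gB] gcont]; split; split.
- exists (`|M| + B) => nu pnu; rewrite (le_trans (ler_normD _ _))// lerD2l.
  exact: gB.
- by move=> nu mu pnu pmu numu; apply: cvgD; [exact: cvg_cst | exact: gcont].
- exists (`|M| + B) => nu pnu; rewrite (le_trans (ler_normB _ _))// lerD2l.
  exact: gB.
- by move=> nu mu pnu pmu numu; apply: cvgB; [exact: cvg_cst | exact: gcont].
Qed.

Lemma cvgd_pp_cell_counts {d2 d3} {T2 : measurableType d2} {T3 : measurableType d3}
    (Q2 : probability T2 R) (Q3 : probability T3 R)
    (Nn : nat -> T2 -> M_) (N : T3 -> M_) :
  (forall n w, point_measure (Nn n w)) -> (forall w, point_measure (N w)) ->
  (forall n m k, measurable [set w | cell_counts m (Nn n w) = k]) ->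
  (forall m k, measurable [set w | cell_counts m (N w) = k]) ->
  (forall m k, fine (Q2 [set w | cell_counts m (Nn n w) = k]) @[n --> \oo] -->
     fine (Q3 [set w | cell_counts m (N w) = k])) ->
  cvgd_pp Q2 Nn Q3 N.
Proof.
move=> pNn pN mNn mN QQ g gcont.
have [M gM] := gcont.1; have [gp gm] := bdd_vague_continuous_shift M gcont.
have gp_ge0 nu : point_measure nu -> 0 <= M + g nu.
  by move=> /gM; rewrite ler_norml; lra.
have gm_ge0 nu : point_measure nu -> 0 <= M - g nu.
  by move=> /gM; rewrite ler_norml; lra.
have mg d (T : measurableType d) (L : T -> M_) : (forall w, point_measure (L w)) ->
    (forall m k, measurable [set w | cell_counts m (L w) = k]) ->
    measurable_fun setT (fun w => g (L w)).
  move=> pL mL; have mp := measurable_vague_continuous gp_ge0 gp pL mL.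
  rewrite (_ : (fun w => _) = (fun w => (M + g (L w)) - M)).
    by apply: measurable_funB.
  by apply/funext => w; rewrite addrAC subrr add0r.
have [r [rE rp rm]] := integral_bounded Q3 (mg _ _ _ pN mN) (fun w => gM _ (pN w)).
have rnP n := integral_bounded Q2 (mg _ _ _ (pNn n) (mNn n)) (fun w => gM _ (pNn n w)).
rewrite rE; apply/fine_cvgP; split.
  by apply: nearW => n; have [? [-> _ _]] := rnP n.
apply/cvgrPdist_lt => e e0.
(* The bound for [M + g] controls the limit from below, the one for [M - g] from above, each with
   slack [e]. *)
have ap : ((M + r - e)%:E < \int[Q3]_w (M + g (N w))%:E)%E by rewrite rp lte_fin; lra.
have am : ((M - r - e)%:E < \int[Q3]_w (M - g (N w))%:E)%E by rewrite rm lte_fin; lra.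
have np := liminf_vague_continuous gp_ge0 gp pNn pN mNn mN QQ ap.
have nm := liminf_vague_continuous gm_ge0 gm pNn pN mNn mN QQ am.
near=> n; have [rn [rnE rnp rnm]] := rnP n.
have hp : ((M + r - e)%:E < \int[Q2]_w (M + g (Nn n w))%:E)%E by near: n.
have hm : ((M - r - e)%:E < \int[Q2]_w (M - g (Nn n w))%:E)%E by near: n.
move: hp hm; rewrite /= rnE rnp rnm !lte_fin /= => hp hm.
by rewrite ltr_norml; apply/andP; split; lra.
Unshelve. all: by end_near. Qed.

End lower_envelope.

(** * Convergence to the Poisson random measure *)

Section poisson_limit.
Context {R : realType}.

Lemma measurable_gt (x : R) : measurable [set y : R | x < y].
Proof.
rewrite (_ : [set y | x < y] = `]x, +oo[%classic)//.
by apply/seteqP; split => y /=; rewrite in_itv/= andbT.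
Qed.

Lemma gt_grid m j :
  [set y : R | grid m j < y] = cell m j `|` [set y | grid m j.+1 < y].
Proof.
apply/seteqP; split => y; rewrite /cell /= in_itv/=.
  by move=> jy; have [yj|] := leP y (grid m j.+1); [left; rewrite jy | right].
by move=> [/andP[]//|]; apply: le_lt_trans; exact: grid_le.
Qed.

Lemma cell_gt_disjoint m j : cell m j `&` [set y : R | grid m j.+1 < y] = set0.
Proof.
apply/seteqP; split => // y; rewrite /cell /= in_itv/= => -[/andP[_ yj] jy].
by have := lt_le_trans jy yj; rewrite ltxx.
Qed.

Lemma NppE {T : Type} (Z : nat -> T -> R) p w (A : set R) :
  Npp Z p w A = (\sum_(i < p) (Z i w \in A))%:R%:E.
Proof.
rewrite /Npp /= /msum natr_sum -sumEFin; apply: eq_bigr => i _.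
exact: diracE.
Qed.

Lemma point_measure_Npp {T : Type} (Z : nat -> T -> R) p w : point_measure (Npp Z p w).
Proof.
split=> [K _|A _]; first by rewrite NppE ltry.
by left; exists (\sum_(i < p) (Z i w \in A))%N; rewrite NppE.
Qed.

Lemma cell_counts_Npp {d} {T : measurableType d} (Z : nat -> T -> R) m p w :
  cell_counts m (Npp Z p w) = hits Z (fun j : 'I_(ncells m) => cell m j) p w.
Proof. by apply/ffunP => j; rewrite !ffunE NppE /= natrK. Qed.

(** * Cell counts of a Poisson random measure *)

Section PRM.
Context {d : measure_display} {T : measurableType d}.
Variables (Q : probability T R) (N : T -> {measure set R -> \bar R}).
Variable mu : {measure set R -> \bar R}.
Hypothesis muE : forall x : R, mu [set y : R | x < y] = (expR (- x))%:E.
Hypothesis prm : is_PRM Q N mu.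

(** A difference of two prescribed tails; finiteness of the larger tail also rules out an infinite
    cell. *)
Lemma mu_cell m j :
  mu (cell m j) = (expR (- grid m j) - expR (- grid m j.+1))%:E.
Proof.
have : (mu [set y | grid m j < y]%R = mu (cell m j) + mu [set y | grid m j.+1 < y]%R)%E.
  rewrite gt_grid; apply: measureU; first exact: measurable_cell.
    exact: measurable_gt.
  exact: cell_gt_disjoint.
rewrite !muE; case: (mu (cell m j)) => // r.
by rewrite -EFinD => -[->]; rewrite addrK.
Qed.

(** The intersection runs over the enumeration of the index type, the shape in which mutual
    independence is stated. *)
Lemma cell_counts_PRM m k :
  [set w | cell_counts m (N w) = k] =
  \bigcap_(j in [set` index_enum 'I_(ncells m)])
    (fun w => N w (cell m j)) @^-1` [set (k j)%:R%:E].
Proof.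
have [pN _] := prm.
apply/seteqP; split => w /=; first by move=> <- j _ /=; exact: cell_countsE.
move=> wk; apply/ffunP => j; have := wk j; rewrite /= mem_index_enum => /(_ isT).
by rewrite ffunE => ->; rewrite /= natrK.
Qed.

Lemma measurable_cell_counts_PRM m k : measurable [set w | cell_counts m (N w) = k].
Proof.
have [_ [mN _]] := prm.
rewrite cell_counts_PRM; apply: fin_bigcap_measurable => // j _.
rewrite -[X in measurable X]setTI; apply: mN => //; exact: measurable_cell.
Qed.

Lemma PRM_cell_counts_prob m k :
  Q [set w | cell_counts m (N w) = k] =
  (poisson_prod_pmf (fun j => expR (- grid m j) - expR (- grid m j.+1)) k)%:E.
Proof.
have [_ [_ [poi [_ ind]]]] := prm.
rewrite cell_counts_PRM (ind _ (fun j : 'I_(ncells m) => cell m j)) //; first last.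
- exact: index_enum_uniq.
- move=> i j /eqP ij; apply/seteqP; split => // x [xi xj].
  by apply: ij; apply/val_inj/(cell_inj xi xj).
- by move=> j; exact: measurable_cell.
rewrite /poisson_prod_pmf -prodEFin; apply: eq_bigr => j _.
have mfin : (mu (cell m j) < +oo)%E by rewrite mu_cell ltry.
have := poi _ (measurable_cell m j) mfin (k j); rewrite mu_cell /= => <-.
by [].
Qed.

End PRM.

(** * Triangular arrays with iid rows *)

Section array.
Context {d : measure_display} {T : measurableType d}.
Variables (Q : probability T R) (Z : nat -> nat -> T -> R) (p : nat -> nat).
Hypothesis mZ : forall n i, measurable_fun setT (Z n i).
Hypothesis indepZ : forall n, mutually_independent Q (Z n).
Hypothesis Z_id : forall n i (B : set R), measurable B ->
  Q (Z n i @^-1` B) = Q (Z n 0%N @^-1` B).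
Hypothesis p_oo : ((p n)%:R : R) @[n --> \oo] --> +oo.
Hypothesis Z_tail : forall x : R,
  (p n)%:R * fine (Q (Z n 0%N @^-1` [set y | x < y])) @[n --> \oo] --> expR (- x).

Lemma cvg_hits_prob J (A : 'I_J -> set R) (lam : 'I_J -> R) k :
  (forall j, measurable (A j)) -> trivIset setT A ->
  (forall j, (p n)%:R * fine (Q (Z n 0%N @^-1` A j)) @[n --> \oo] --> lam j) ->
  fine (Q [set w | hits (Z n) A (p n) w = k]) @[n --> \oo] --> poisson_prod_pmf lam k.
Proof.
move=> mA tA Alam.
have qE n i j : Q (Z n i @^-1` A j) = (fine (Q (Z n 0%N @^-1` A j)))%:E.
  by rewrite (Z_id _ _ (mA j)) fineK// fin_num_measure//; exact: Z_preimage_measurable.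
under eq_fun => n do rewrite (hits_prob (mZ n) mA tA (indepZ n) (qE n)) /=.
by apply: cvg_multinomial_pmf => // n j; exact: fine_ge0.
Qed.

Lemma cvg_max_prob x :
  fine (Q [set w | maxZ (Z n) (p n) w <= x]) @[n --> \oo] --> expR (- expR (- x)).
Proof.
(* The maximum is at most [x] exactly when this single cell receives no point. *)
pose A (_ : 'I_1) : set R := [set y | x < y].
have tA : trivIset setT A by move=> i j _ _ _; rewrite !ord1.
have := @cvg_hits_prob 1 A (fun=> expR (- x)) [ffun=> 0%N] (fun=> measurable_gt x) tA
  (fun=> @Z_tail x).
rewrite /poisson_prod_pmf big_ord1 ffunE expr0 fact0 mulr1 divr1.
apply: cvg_trans; apply: near_eq_cvg; near=> n.
(* [maxZ] starts from the point of index 0, which is one of the [p n] points only if [p n] is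
   positive. *)
have p0 : (0 < p n)%N by rewrite -(ltr_nat R); near: n; exact: (cvgry_gt p_oo).
congr (fine (Q _)); apply/seteqP; split => w /=.
  move=> hw; apply/bigmax_leP; suff le i : (i < p n)%N -> Z n i w <= x.
    by split => [|i _]; exact: le.
  move=> ip; rewrite leNgt; apply/negP => xZ.
  move/ffunP/(_ ord0): hw; rewrite !ffunE => /eqP.
  rewrite sum_nat_eq0 => /forallP/(_ (Ordinal ip))/=.
  by rewrite mem_set.
move/bigmax_leP => [_ le]; apply/ffunP => j; rewrite !ffunE big1// => i _.
by rewrite memNset// /A /= => xZ; have := lt_le_trans xZ (le i isT); rewrite ltxx.
Unshelve. all: by end_near. Qed.

Lemma cvgd_pp_PRM {d3} {T3 : measurableType d3} (Q3 : probability T3 R)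
    (N : T3 -> {measure set R -> \bar R}) (mu : {measure set R -> \bar R}) :
  (forall x : R, mu [set y : R | x < y] = (expR (- x))%:E) -> is_PRM Q3 N mu ->
  cvgd_pp Q (fun n => Npp (Z n) (p n)) Q3 N.
Proof.
move=> muE prm.
have mcell m (j : 'I_(ncells m)) : measurable (cell m j : set R) by exact: measurable_cell.
apply: cvgd_pp_cell_counts.
- by move=> n w; exact: point_measure_Npp.
- by case: prm.
- move=> n m k; under eq_set do rewrite cell_counts_Npp.
  exact: hits_measurable.
- by move=> m k; exact: (measurable_cell_counts_PRM prm).
move=> m k; rewrite (PRM_cell_counts_prob muE prm) /=.
under eq_fun => n do under eq_set do rewrite cell_counts_Npp.
apply: cvg_hits_prob => // [|j]; first exact: trivIset_cell_ord.
(* The hypothesis concerns tails only, so a cell is treated as a difference of two tails. *)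
have diffE n : fine (Q (Z n 0%N @^-1` cell m j)) =
    fine (Q (Z n 0%N @^-1` [set y | grid m j < y])) -
    fine (Q (Z n 0%N @^-1` [set y | grid m j.+1 < y])).
  have mZB B : measurable B -> measurable (Z n 0%N @^-1` B).
    by move=> mB; exact: Z_preimage_measurable.
  rewrite [in X in _ = fine X - _]gt_grid preimage_setU measureU; first last.
  - by rewrite -preimage_setI cell_gt_disjoint preimage_set0.
  - by apply: mZB; exact: measurable_gt.
  - by apply: mZB; exact: measurable_cell.
  rewrite fineD ?addrK// fin_num_measure//; apply: mZB; first exact: measurable_cell.
  exact: measurable_gt.
under eq_fun => n do rewrite diffE mulrBr.
by apply: cvgB; exact: Z_tail.
Qed.

End array.
End poisson_limit.

(** * The tail limit and the two equivalences *)

Lemma mutually_independent_comp {R : realType} {d d1 d2} {T : measurableType d}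
    {V : measurableType d1} {W : measurableType d2} {I : eqType}
    (P : probability T R) (Y : I -> T -> V) (h : V -> W) :
  measurable_fun setT h -> mutually_independent P Y ->
  mutually_independent P (fun i => h \o Y i).
Proof.
move=> mh indY J B uJ mB; apply: (indY J (fun i => h @^-1` B i) uJ) => i.
by rewrite -[X in measurable X]setTI; exact: mh.
Qed.

Unset Implicit Arguments.

Theorem theorem4p3
  (R : realType) (d : measure_display) (T : measurableType d)
  (P : probability T R)
  (X : nat -> {RV P >-> R})
  (X_indep : mutually_independent P (fun i => (X i : T -> R)))
  (X_id : identically_distributed P (fun i => (X i : T -> R)))
  (X_nonneg : P [set w | X 0%N w < 0] = 0%E)
  (X_unbdd : forall x : R, 0 < tailP P (X 0%N) x)
  (X_int : P.-integrable setT (EFin \o X 0%N))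
  (F_subexp : subexponential P (fun i => (X i : T -> R)))
  (F_gumbel : gumbel_MDA (tailP P (X 0%N)))
  (c dn : nat -> R) (c_pos : forall n, 0 < c n)
  (cd_norm : forall x : R,
     (n%:R * tailP P (X 0%N) (dn n + x * c n)) @[n --> \oo] --> expR (- x))
  (gamma : nat -> R) (gamma_oo : gamma n @[n --> \oo] --> +oo)
  (gamma_unif : forall eps : R, 0 < eps -> \forall n \near \oo,
     forall x : R, gamma n < x ->
       `| tailP P (fun w => Ssum (fun i => (X i : T -> R)) n w
                              - ES P (fun i => (X i : T -> R)) n) x
          / (n%:R * tailP P (X 0%N) x) - 1 | <= eps)
  (p : nat -> nat) (p_oo : ((p n)%:R : R) @[n --> \oo] --> +oo)
  (p_gamma : forall x : R, x < 0 -> \forall n \near \oo,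
     gamma n < dn (n * p n)%N + x * c (n * p n)%N)
  (d2 : measure_display) (T2 : measurableType d2) (Q : probability T2 R)
  (Sa : nat -> nat -> {RV Q >-> R})
  (Sa_indep : forall n, mutually_independent Q (fun i => (Sa n i : T2 -> R)))
  (Sa_law : forall n i (B : set R), measurable B ->
     Q (Sa n i @^-1` B) = P (Ssum (fun j => (X j : T -> R)) n @^-1` B)) :
  let S n w := Ssum (fun j => (X j : T -> R)) n w in
  let ESn n := ES P (fun j => (X j : T -> R)) n in
  let Z n i w := (Sa n i w - ESn n - dn (n * p n)%N) / c (n * p n)%N in
  let star := forall x : R,
    ((p n)%:R * tailP P (fun w => S n w - ESn n) (dn (n * p n)%N + x * c (n * p n)%N))
      @[n --> \oo] --> expR (- x) in
  star /\
  (star <->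
     (forall (d3 : measure_display) (T3 : measurableType d3)
             (Q3 : probability T3 R) (N : T3 -> {measure set R -> \bar R})
             (mu : {measure set R -> \bar R}),
        (forall x : R, mu [set y : R | x < y] = (expR (- x))%:E) ->
        is_PRM Q3 N mu ->
        cvgd_pp Q (fun n => Npp (Z n) (p n)) Q3 N)) /\
  (star <->
     (forall x : R,
        fine (Q [set w | maxZ (Z n) (p n) w <= x]) @[n --> \oo]
          --> expR (- expR (- x)))).
Proof.
move=> S ESn Z star.
(* Allows [cd_norm] to be evaluated along the indices [n * p n]. *)
have np_oo : (n * p n)%N @[n --> \oo] --> \oo.
  apply/cvgnyPge => A; near=> n.
  have p1 : (0 < p n)%N by rewrite -(ltr_nat R); near: n; exact: (cvgry_gt p_oo).
  have An : (A <= n)%N by near: n; exact: nbhs_infty_ge.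
  by rewrite (leq_trans An)// leq_pmulr.
have star_holds : star.
  move=> x; set y := fun n => dn (n * p n)%N + x * c (n * p n)%N.
  have y_gamma : \forall n \near \oo, gamma n < y n.
    (* For [x >= 0] the point lies to the right of the one for [-1], since [c] is positive. *)
    have [x0|x0] := ltP x 0; first exact: p_gamma.
    have := p_gamma (-1) (ltrN10 _); apply: filterS => n /lt_le_trans; apply.
    by rewrite lerD2l ler_pM2r// (le_trans _ x0)// lerN10.
  (* The ratio in the large deviation bound. Multiplied by [n * p n] times the tail of [X 0] at
     [y n], it leaves the quantity in [star]. *)
  pose r n := tailP P (fun w => S n w - ESn n) (y n) / (n%:R * tailP P (X 0%N) (y n)).
  have r1 : r n @[n --> \oo] --> (1 : R).
    apply/cvgrPdist_le => e e0; have := gamma_unif e e0.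
    by apply: filterS2 y_gamma => n gy /(_ _ gy); rewrite distrC.
  have Fy : (n * p n)%:R * tailP P (X 0%N) (y n) @[n --> \oo] --> expR (- x).
    exact: (cvg_comp _ _ np_oo (cd_norm x)).
  rewrite -[expR _]mul1r.
  apply: cvg_trans (cvgM r1 Fy); apply: near_eq_cvg; near=> n.
  have n0 : (n%:R : R) != 0.
    by rewrite pnatr_eq0 -lt0n; near: n; exact: nbhs_infty_gt.
  have F0 : tailP P (X 0%N) (y n) != 0 by rewrite gt_eqF.
  by rewrite /r /= -/(y n) natrM; field; rewrite n0 F0.
(* The affine map taking [Sa n i] to [Z n i]; independence and laws are transported along it. *)
pose h n (s : R) := (s - ESn n - dn (n * p n)%N) / c (n * p n)%N.
have mh n : measurable_fun setT (h n).
  by apply: measurable_funM => //; do 2 apply: measurable_funB => //.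
have mZ n i : measurable_fun setT (Z n i) by exact: (measurableT_comp (mh n) (measurable_funPT (Sa n i))).
have indepZ n : mutually_independent Q (Z n).
  exact: (mutually_independent_comp (mh n) (Sa_indep n)).
have Z_law n i (B : set R) : measurable B -> Q (Z n i @^-1` B) = P (S n @^-1` (h n @^-1` B)).
  by move=> mB; apply: (Sa_law n i); rewrite -[X in measurable X]setTI; exact: mh.
have Z_id n i (B : set R) : measurable B -> Q (Z n i @^-1` B) = Q (Z n 0%N @^-1` B).
  by move=> mB; rewrite !Z_law.
have Z_tail x : (p n)%:R * fine (Q (Z n 0%N @^-1` [set y | x < y])) @[n --> \oo] --> expR (- x).
  apply: cvg_trans (star_holds x); apply: near_eq_cvg; apply: nearW => n.
  rewrite Z_law; last exact: measurable_gt.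
  have hE s : (x < h n s) = (dn (n * p n)%N + x * c (n * p n)%N < s - ESn n).
    by rewrite /h ltr_pdivlMr// ltrBrDl.
  by congr (_ * fine (P _)); apply/seteqP; split => w /=; rewrite hE.
split; first exact: star_holds.
split; split => // _.
  by move=> d3 T3 Q3 N mu muE prm; exact: (cvgd_pp_PRM mZ indepZ Z_id p_oo Z_tail muE prm).
by move=> x; exact: (cvg_max_prob mZ indepZ Z_id p_oo Z_tail).
Unshelve. all: by end_near. Qed.
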